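(* $\mathfrak{ap}\leq\mathfrak{at}=\mathfrak q_2$.
   Context: $[\omega]^{\aleph_0}$ is the set of infinite subsets of $\omega$. For $\mathcal A,\mathcal B\subseteq[\omega]^{\aleph_0}$, $\mathcal A\perp\mathcal B$ means that $a\cap b$ is finite for all $a\in\mathcal A$, $b\in\mathcal B$. $\mathcal A$ is weakly separated from $\mathcal B$ if there is $X\subseteq\omega$ such that $a\cap X$ is infinite for every $a\in\mathcal A$ and $b\cap X$ is finite for every $b\in\mathcal B$. A family is almost disjoint if any two distinct members have finite intersection. $\mathfrak{ap}$ is the least cardinal $\kappa$ for which there exist $\mathcal A,\mathcal B\subseteq[\omega]^{\aleph_0}$ such that $\mathcal A\perp\mathcal B$, $|\mathcal A\cup\mathcal B|=\kappa$, $\mathcal A\cup\mathcal B$ is an almost disjoint family, and $\mathcal A$ is not weakly separated from $\mathcal B$. An $\omega$-tree is a rooted tree of height $\omega$ with finite levels. A subtree of a tree is a nonempty downward closed subset; an infinite subtree is one with infinitely many nodes. A family of subtrees is almost disjoint if any two distinct members have finite intersection. $\mathfrak{at}$ is the least cardinal $\kappa$ for which there are an $\omega$-tree $T$, an almost disjoint family $\mathcal X$ of infinite subtrees of $T$ with $|\mathcal X|\leq\kappa$, and $\mathcal Y\subseteq\mathcal X$ such that there is no $D\subseteq T$ with $D\cap Y$ infinite for all $Y\in\mathcal Y$ and $D\cap Z$ finite for all $Z\in\mathcal X\setminus\mathcal Y$. A $Q$-space is a topological space in which every subset is a $G_\delta$ set (equivalently, every subset is $F_\sigma$). $\mathfrak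 q_2$ is the least cardinality of a second-countable Hausdorff space that is not a $Q$-space. *)

(* Defs.v *)
From mathcomp Require Import all_boot all_order.
From mathcomp Require Import all_classical wochoice topology borel_hierarchy.

Set Implicit Arguments.
Unset Strict Implicit.
Unset Printing Implicit Defensive.

Local Open Scope classical_set_scope.
Local Open Scope card_scope.

(* A cardinal is represented by any type of that cardinality; this determines
   [K] up to bijection (Cantor-Bernstein). *)
Definition least_cardinal (P : Type -> Prop) (K : Type) : Prop :=
  P K /\ forall L : Type, P L -> [set: K] #<= [set: L].

Definition almost_disjoint (T : Type) (F : set (set T)) : Prop :=
  forall a b, F a -> F b -> a <> b -> finite_set (a `&` b).

(* The members of [omega]^{aleph_0}. *)
Definition infinite_subsets : set (set nat) := [set a | infinite_set a].

Definition orthogonal (A B : set (set nat)) : Prop :=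
  forall a b, A a -> B b -> finite_set (a `&` b).

Definition weakly_separated (A B : set (set nat)) : Prop :=
  exists X : set nat,
    (forall a, A a -> infinite_set (a `&` X)) /\
    (forall b, B b -> finite_set (b `&` X)).

Definition ap_witnessed (K : Type) : Prop :=
  exists A B : set (set nat),
    [/\ A `<=` infinite_subsets /\ B `<=` infinite_subsets,
        orthogonal A B,
        A `|` B #= [set: K],
        almost_disjoint (A `|` B)
      & ~ weakly_separated A B].

Definition is_ap : Type -> Prop := least_cardinal ap_witnessed.

Section Trees.
Context {d : Order.disp_t} (T : porderType d).

Definition is_tree : Prop :=
  forall t : T, wo_chain <=%O [pred s : T | (s < t)%O].

(* In a tree, a well-ordered set of predecessors has order type [n < omega]
   exactly when it has [n] elements. *)
Definition level (n : nat) : set T := [set t | [set s | (s < t)%O] #= `I_n].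

Definition rooted : Prop := exists r : T, forall t : T, (r <= t)%O.

(* The least ordinal [alpha] whose level is empty is [omega]: all finite levels
   are inhabited, and no node lies beyond them. *)
Definition height_omega : Prop :=
  (forall n, level n !=set0) /\ (forall t : T, exists n, level n t).

Definition omega_tree : Prop :=
  [/\ is_tree, rooted, height_omega & forall n, finite_set (level n)].

Definition subtree (S : set T) : Prop :=
  S !=set0 /\ forall s t : T, S t -> (s <= t)%O -> S s.

End Trees.

Definition at_witnessed (K : Type) : Prop :=
  exists (d : Order.disp_t) (T : porderType d) (X Y : set (set T)),
    [/\ omega_tree T,
        (forall S, X S -> subtree S /\ infinite_set S) /\ almost_disjoint X,
        X #<= [set: K],
        Y `<=` X
      & ~ exists D : set T,
            (forall S, Y S -> infinite_set (D `&` S)) /\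
            (forall Z, (X `\` Y) Z -> finite_set (D `&` Z))].

Definition is_at : Type -> Prop := least_cardinal at_witnessed.

Definition Q_space (X : topologicalType) : Prop := forall S : set X, Gdelta S.

Definition q2_witnessed (K : Type) : Prop :=
  exists X : topologicalType,
    [/\ @second_countable X, hausdorff_space X, ~ Q_space X
      & [set: X] #= [set: K]].

Definition is_q2 : Type -> Prop := least_cardinal q2_witnessed.

(* Main.v *)
Require Import Defs.
From HB Require Import structures.
From mathcomp Require Import all_boot all_order.
From mathcomp Require Import all_classical wochoice topology borel_hierarchy.

(** The three cardinals exist because every nonempty class of cardinals has a
least member ([least_cardinal_exists]) and because witnesses exist: a diagonal
argument on the binary tree ([at_witnessed_cantor]) gives one for [at], and the
inequalities below produce the others.

The inequality between [ap] and [at] holds because an omega-tree is countable: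
a family of subtrees is in particular a family of subsets of [nat], and the
condition on the separating set is the same ([ap_of_at]).

For the equality of [at] and [q2], each witness is turned into a witness of the
other kind, of no larger cardinality.  Both directions need to choose one
function that eventually dominates one function per point.  When this is
impossible, the undominated family itself provides both witnesses, through a
set of reals concentrated on a countable set ([undominated_witnesses]).  So
assume that it is possible.

From a second-countable Hausdorff space ([at_of_q2]), attach to each point the
tree of finite sequences of closed sets containing it, where the closed sets
are the complements of the members of disjoint pairs of basic open sets.
Distinct points have almost disjoint trees because the space is Hausdorff, and
a separating set of nodes, cut into finite blocks by domination, shows that the
set of points in question is an F-sigma set.

From an almost disjoint family of subtrees ([q2_of_at]), first shrink the trees
to be hit by the separating set to branches.  The sets of trees that
avoid a given finite set of nodes generate a second-countable topology,
Hausdorff because two almost disjoint trees have disjoint traces on a high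
level, which every infinite subtree must meet.  If the family of branches is
an F-sigma set of this space, then it is a countable union of pieces each of
which spans a set of nodes almost disjoint from every other tree of the family.
Domination glues these sets of nodes, after removing finite parts, into a
separating set. *)

Set Implicit Arguments.
Unset Strict Implicit.
Unset Printing Implicit Defensive.

Local Open Scope classical_set_scope.
Local Open Scope card_scope.

(** * Cardinals and their least elements *)

Lemma inj_card_leT (T U : Type) (f : T -> U) :
  injective f -> [set: T] #<= [set: U].
Proof.
move=> finj; rewrite (card_le_trans _ (card_leT (range f)))//.
by move: (card_esym (@inj_card_eq _ _ [set: T] f (in2W finj))); rewrite card_eq_le => /andP[].
Qed.

Lemma card_leT_inj (T U : Type) :
  [set: T] #<= [set: U] -> exists f : T -> U, injective f.
Proof.
move=> /card_leP[F].
exists (fun t => val (F (SigSub (mem_set (I : [set: T] t))))) => s t /val_inj.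
by move=> /(@inj _ _ _ F); rewrite !inE => /(_ I I) [].
Qed.

Lemma card_set_sig (T : Type) (A : set T) : [set: {x : T | A x}] #= A.
Proof.
have inj_sval : injective (@sval T A).
  by move=> [x Ax] [y Ay] /= xy; apply/eq_exist.
have rangeA : range (@sval T A) = A.
  apply/seteqP; split=> [_ [[x Ax] _ <-//]|x Ax].
  by exists (exist _ x Ax).
have := @inj_card_eq _ _ setT (@sval T A) (in2W inj_sval).
by rewrite rangeA card_eq_sym.
Qed.

(** This is why every nonempty family of cardinals has a least one.  A maximal
set [F] of choice functions on which all the projections are injective must
project onto some [X j]: otherwise a choice function made of missed values
could be added to [F].  Inverting that projection sends [X j] into [F], and
the other projections send [F] into every [X k]. *)
Lemma surjective_projection_exists (J : Type) (X : J -> Type) (i : J) :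
  exists j, forall k, [set: X j] #<= [set: X k].
Proof.
pose P (F : set (forall j, X j)) :=
  forall j x y, F x -> F y -> x j = y j -> x = y.
have [|F [PF maxF]] := @Zorn_bigcup _ P.
  move=> C CP Ctot j x y [A CA Ax] [B CB By].
  have [AB|BA] := Ctot _ _ CA CB; first exact: (CP _ CB _ _ _ (AB _ Ax) By).
  exact: (CP _ CA _ _ _ Ax (BA _ By)).
have [j /choice[s sP]] : exists j, forall a : X j, exists x, F x /\ x j = a.
  apply: contrapT => nsurj.
  have /all_sig[a aP] j : {a : X j | forall x, F x -> x j <> a}.
    apply: cid; apply: contrapT => na; apply: nsurj; exists j => a.
    apply: contrapT => nx; apply: na; exists a => x Fx xa.
    by apply: nx; exists x.
  apply: (maxF (F `|` [set a])).
    split; first by move=> x; left.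
    by move=> /(_ a (or_intror erefl)) Fa; apply: (aP i _ Fa).
  move=> j x y [Fx|->] [Fy|->] // xy; first exact: PF xy.
    by case: (aP j x Fx).
  by case: (aP j y Fy).
exists j => k; apply: (@inj_card_leT _ _ (fun a => s a k)) => a b sab.
have [Fa <-] := sP a; have [Fb <-] := sP b.
by rewrite (PF _ _ _ Fa Fb sab).
Qed.

Lemma card_le_total (K L : Type) :
  [set: K] #<= [set: L] \/ [set: L] #<= [set: K].
Proof.
have [[] le] := @surjective_projection_exists bool (fun b => if b then K else L) true.
  by left; exact: (le false).
by right; exact: (le true).
Qed.

(** The competitors range over a large universe, but those below [K0] are
equinumerous with subsets of [K0], so a minimum over these subsets suffices;
any other competitor is above [K0] by comparability. *)
Lemma least_cardinal_exists (P : Type -> Prop) (K0 : Type) :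
  (forall K L : Type, [set: K] #= [set: L] -> P K -> P L) -> P K0 ->
  exists K, least_cardinal P K.
Proof.
move=> Piso PK0.
have PT : P {x : K0 | [set: K0] x}.
  by apply: Piso PK0; rewrite card_eq_sym card_set_sig.
pose X (S : {S : set K0 | P {x : K0 | S x}}) := {x : K0 | sval S x}.
have [[S PS] leS] := @surjective_projection_exists _ X (exist _ _ PT).
exists {x : K0 | S x}; split=> // L PL.
have [KL|/card_leT_inj[f finj]] := card_le_total K0 L.
  apply: card_le_trans KL; have := leS (exist _ _ PT).
  by rewrite /X/= (card_le_eqr (card_set_sig _)).
have fL : [set: L] #= [set: {x : K0 | range f x}].
  by rewrite (card_eqr (card_set_sig _)) card_eq_sym inj_card_eq//; exact: in2W.
have := leS (exist _ _ (Piso _ _ fL PL)); rewrite /X/=.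
by rewrite (card_le_eqr fL).
Qed.

(** * Topologies with a countable subbase *)

(** The parameter [S] only labels the type, so that it determines the
topology which canonical structures attach to [W]. *)
Definition generated_space (W : Type) (S : nat -> set W) : Type := W.

Section GeneratedSpace.
Variables (W : Type) (S : nat -> set W).

Definition basic_open (s : seq nat) : set (generated_space S) :=
  [set w | forall i, i \in s -> S i w].

Let generated_open (O : set (generated_space S)) :=
  forall w, O w -> exists2 s, basic_open s w & basic_open s `<=` O.

Let generated_openT : generated_open setT.
Proof. by move=> w _; exists [::]. Qed.

Let generated_openI : setI_closed generated_open.
Proof.
move=> A B Aop Bop w [/Aop[s sw sA] /Bop[t tw tB]]; exists (s ++ t).
  by move=> i; rewrite mem_cat => /orP[/sw|/tw].
by move=> v stv; split; [apply: sA|apply: tB] => i it; apply: stv;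
  rewrite mem_cat it ?orbT.
Qed.

Let generated_open_bigcup (I : Type) (f : I -> set (generated_space S)) :
  (forall i, generated_open (f i)) -> generated_open (\bigcup_i f i).
Proof.
move=> fop w [i _ /(fop i)[s sw sf]]; exists s => //.
by move=> v /sf; exists i.
Qed.

HB.instance Definition _ := gen_eqMixin (generated_space S).
HB.instance Definition _ := gen_choiceMixin (generated_space S).
HB.instance Definition _ := isOpenTopological.Build (generated_space S)
  generated_openT generated_openI generated_open_bigcup.

Lemma generated_openP (O : set (generated_space S)) : open O <->
  forall w, O w -> exists2 s, basic_open s w & basic_open s `<=` O.
Proof. by []. Qed.

Lemma basic_open_open (s : seq nat) : open (basic_open s).
Proof. by apply/generated_openP => w sw; exists s. Qed.

Lemma generated_second_countable : @second_countable (generated_space S).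
Proof.
exists (range basic_open); first exact: sub_countable (card_image_le _ _) (countableP _).
split=> [_ [s _ <-]|w U]; first exact: basic_open_open.
rewrite nbhsE => -[O [/generated_openP Oop /Oop[s sw sO]] OU].
exists (basic_open s); first by split=> //; exists s.
exact: subset_trans OU.
Qed.

Lemma generated_hausdorff :
  (forall v w : W, v <> w -> exists s t, [/\ basic_open s v, basic_open t w
     & forall u, basic_open s u -> ~ basic_open t u]) ->
  hausdorff_space (generated_space S).
Proof.
move=> sep; rewrite open_hausdorff => v w /eqP/sep[s [t [sv tw st]]].
exists (basic_open s, basic_open t); first by split; apply: mem_set.
split; [exact: basic_open_open|exact: basic_open_open|].
by apply/eqP/seteqP; split=> // u [/st].
Qed.

End GeneratedSpace.

(** * Families of functions without an eventual upper bound *)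

Definition eventually_dominated (K : Type) (f : K -> nat -> nat) : Prop :=
  exists G : nat -> nat, forall k, exists n0, forall n, n0 <= n -> f k n <= G n.

(** The diagonal argument: a pointwise bound by one of countably many functions
is improved to an eventual bound by their running maximum. *)
Lemma countably_bounded_dominated (K : Type) (f : K -> nat -> nat)
    (H : nat -> nat -> nat) :
  (forall k, exists i, forall n, f k n <= H i n) -> eventually_dominated f.
Proof.
move=> fH; exists (fun n => \max_(i < n.+1) H i n) => k.
have [i fHi] := fH k; exists i => n lein.
by apply: leq_trans (fHi n) (leq_bigmax (Ordinal (lein : i < n.+1))).
Qed.

(** Countable families are dominated, by the diagonal argument. *)
Lemma undominated_infinite (K : Type) (f : K -> nat -> nat) :
  ~ eventually_dominated f -> infinite_set [set: K].
Proof.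
move=> fND /finite_set_countable/countable_injP[c cinj]; apply: fND.
have /choice[H HP] (i : nat) : exists h : nat -> nat, forall k, c k = i -> h = f k.
  have [[k cki]|nk] := pselect (exists k, c k = i).
    by exists (f k) => k' ck'; congr f; apply: cinj; rewrite ?inE// cki.
  by exists (fun=> 0) => k ck; case: nk; exists k.
apply: (@countably_bounded_dominated _ f H) => k.
by exists (c k) => n; rewrite (HP _ k erefl).
Qed.

(** Half of a copy of [nat] inside [K] makes room for the extra countable set;
the other half takes over the points of the copy. *)
Lemma card_range_setU_countable (K T : Type) (f : K -> T) (b : nat -> T) :
  infinite_set [set: K] -> range f `|` range b #<= [set: K].
Proof.
move=> /infiniteP/card_leT_inj[e einj].
have /choice[g gP] (k : K) : exists t : T,
    (forall n, k = e n.*2 -> t = b n) /\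
    (forall n, k = e n.*2.+1 -> t = f (e n)) /\
    ((forall n, k <> e n) -> t = f k).
  have [[n ->]|nk] := pselect (exists n, k = e n); last first.
    exists (f k); split; [|split] => // n kn; case: nk;
    by [exists n.*2|exists n.*2.+1].
  exists (if odd n then f (e n./2) else b n./2); split; [|split].
  - by move=> m /einj ->; rewrite odd_double doubleK.
  - by move=> m /einj ->; rewrite /= odd_double /= uphalf_double.
  - by move=> /(_ n).
apply: card_le_trans (card_image_le g _); apply: subset_card_le.
move=> _ [[k _ <-]|[n _ <-]]; last first.
  by exists (e n.*2) => //; exact: (gP _).1.
have [[n kn]|nk] := pselect (exists n, k = e n).
  by exists (e n.*2.+1) => //; rewrite kn; exact: (gP _).2.1.
by exists k => //; apply: (gP _).2.2 => n kn; apply: nk; exists n.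
Qed.

Definition pad (s : seq bool) : nat -> bool := nth false s.

Definition indicator (g : nat -> nat) : nat -> bool :=
  fun i => `[< exists j, g j = i >].

Lemma neq_fun_exists (T U : Type) (x y : T -> U) :
  x <> y -> exists i, x i <> y i.
Proof.
move=> xy; apply: contrapT => nxy; apply: xy; apply/funext => i.
by apply: contrapT => xyi; apply: nxy; exists i.
Qed.

Lemma neq_mkseq_exists (x y : nat -> bool) n :
  mkseq x n <> mkseq y n -> exists2 i, i < n & x i <> y i.
Proof.
move=> xy; apply: contrapT => nxy; apply: xy; apply/eq_in_map => i.
rewrite mem_iota add0n => /andP[_ lt_in]; apply: contrapT => xyi.
by apply: nxy; exists i.
Qed.

(** If countably many open sets contain all the eventually zero sequences, but
each [indicator (g k)] is missing from one of them, then the functions [g k]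
cannot grow too fast.  For a fixed [n], let [H n l] bound the length at which
the eventually zero extension of a string of length at most [l] is recognised
as a member of the open set coded by [O n]; there are finitely many such
strings.  If [indicator (g k)] is outside this open set, then it cannot
continue its first [l] values by zeros up to [H n l], so [g k] has a value
between [l] and [H n l], for every [l].  Iterating [H n] therefore bounds
[g k], and the countably many bounds are diagonalised. *)
Lemma dominated_of_string_sets (K : Type) (g : K -> nat -> nat)
    (O : nat -> set (seq bool)) :
  (forall k j, g k j < g k j.+1) ->
  (forall n s, exists m, O n (mkseq (pad s) m)) ->
  (forall k, exists n, forall m, ~ O n (mkseq (indicator (g k)) m)) ->
  eventually_dominated g.
Proof.
move=> gS Opad Og.
have /choice[h hP] (ns : nat * seq bool) : exists m, O ns.1 (mkseq (pad ns.2) m).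
  exact: Opad.
pose H n l := \max_(i < l.+1) \max_(s : i.-tuple bool) h (n, tval s).
have hH n l s : size s <= l -> h (n, s) <= H n l.
  move=> sl.
  apply: leq_trans (leq_bigmax (Ordinal (sl : size s < l.+1))) => /=.
  by apply: leq_trans (leq_bigmax (in_tuple s)).
have HS n l l' : l <= l' -> H n l <= H n l'.
  move=> ll'; apply/bigmax_leqP => i _; apply/bigmax_leqP => s _.
  by apply: hH; rewrite size_tuple; apply: leq_trans ll'; rewrite -ltnS.
pose B n j := iter j (fun b => H n b.+1) (H n 0).
apply: (@countably_bounded_dominated _ g B) => k.
have gmono : {mono g k : i j / i <= j}.
  by apply: leq_mono; apply: homo_ltn (gS k); exact: ltn_trans.
have [n On] := Og k; exists n.
have next l : exists2 j, l <= g k j & g k j < H n l.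
  pose s := mkseq (indicator (g k)) l.
  have szs : size s = l by rewrite size_mkseq.
  have := hP (n, s); set m := h _ => /= Om.
  have [|i lt_im neq] := @neq_mkseq_exists (indicator (g k)) (pad s) m.
    by move=> E; apply: (On m); rewrite E.
  have le_li : l <= i.
    rewrite leqNgt; apply/negP => lt_il; apply: neq.
    by rewrite /pad nth_mkseq.
  move: neq; rewrite /pad nth_default ?szs//.
  move=> /eqP; rewrite eqbF_neg negbK => /asboolP[j gj].
  exists j; rewrite gj//; apply: leq_trans (lt_im) _.
  by apply: hH; rewrite szs.
elim=> [|j IHj].
  have [j _ lt_j] := next 0; apply: leq_trans (ltnW lt_j).
  by rewrite gmono.
have [j' lt_j lt_H] := next (g k j).+1.
have /(leq_trans _) : g k j' <= B n j.+1.
  by apply: leq_trans (ltnW lt_H) _; apply: HS.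
by apply; rewrite gmono ltnNge -gmono -ltnNge.
Qed.

(** * The binary tree *)

(** An alias, so that extension of strings can be its order. *)
Definition binary_tree : Type := seq bool.

HB.instance Definition _ := Choice.on binary_tree.

Section BinaryTree.
Implicit Types s t : binary_tree.

Let prefix_anti : antisymmetric (fun s t : binary_tree => prefix s t).
Proof.
move=> s t /andP[st ts]; have /eqP size_st : size s == size t.
  by rewrite eqn_leq !size_prefix.
by move: st; rewrite prefixE size_st take_size => /eqP.
Qed.

HB.instance Definition _ := Order.Le_isPOrder.Build (Order.Disp tt tt) binary_tree
  (@prefix_refl bool) prefix_anti (@prefix_trans bool).

Lemma binary_leE s t : (s <= t)%O = (take (size s) t == s).
Proof. exact: prefixE. Qed.

Lemma binary_ltE s t : (s < t)%O = (size s < size t) && (take (size s) t == s).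
Proof.
rewrite Order.POrderTheory.lt_neqAle binary_leE andbC [RHS]andbC.
case: eqP => //= st; have sz : size s <= size t by rewrite -st size_take_min geq_minr.
rewrite ltn_neqAle sz andbT; congr (~~ _); apply/eqP/eqP => [->//|E].
by rewrite -st E take_size.
Qed.

Lemma binary_predecessors t : [set s | (s < t)%O] = (take^~ t) @` `I_(size t).
Proof.
apply/seteqP; split=> [s/=|_ [n /= ltn <-]] ; rewrite binary_ltE.
  by move=> /andP[lt /eqP E]; exists (size s).
by rewrite size_take_min (minn_idPl (ltnW ltn)) ltn eqxx.
Qed.

Lemma binary_levelE n t : level n t <-> size t = n.
Proof.
rewrite /level/= binary_predecessors.
have inj_take : {in `I_(size t) &, injective (take^~ t)}.
  move=> i j /set_mem/= it /set_mem/= jt /(congr1 size).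
  by rewrite !size_take_min !(minn_idPl (ltnW _)).
by rewrite (card_eql (inj_card_eq inj_take)); split=> [/card_eq_II//|->//]; apply/card_eq_II.
Qed.

Lemma binary_finiteP (A : set binary_tree) :
  finite_set A <-> exists n, forall s, A s -> size s < n.
Proof.
split=> [/finite_seqP[l Al]|[n An]].
  exists (\max_(s <- l) size s).+1 => s; rewrite Al /= => sl.
  by rewrite ltnS; apply: leq_bigmax_seq.
pose l := flatten [seq [seq tval s | s : i.-tuple bool] | i <- iota 0 n].
apply: sub_finite_set (finite_seq l) => s /An lt_sn.
apply/flatten_mapP; exists (size s); first by rewrite mem_iota.
by apply/mapP; exists (in_tuple s); rewrite ?mem_enum.
Qed.

Lemma binary_omega_tree : omega_tree binary_tree.
Proof.
split.
- move=> t; apply: antisymmetric_wo_chain.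
    by move=> x y _ _; exact: Order.POrderTheory.le_anti.
  move=> A sA [x Ax].
  have lt_t y : y \in A -> y = take (size y) t.
    by move=> /sA; rewrite inE/= binary_ltE => /andP[_ /eqP].
  have ex : exists n, take n t \in A by exists (size x); rewrite -lt_t.
  case: (ex_minnP ex) => n An n_min; exists (take n t); split=> // y Ay.
  have n_le_y : n <= size y by apply: n_min; rewrite -lt_t.
  rewrite binary_leE size_take_min [X in take _ X](lt_t _ Ay).
  by rewrite take_takel ?geq_min ?n_le_y// take_min take_size.
- by exists ([::] : binary_tree) => t; exact: prefix0s.
- split=> [n|t]; last by exists (size t); apply/binary_levelE.
  by exists (nseq n false); apply/binary_levelE; rewrite size_nseq.
- by move=> n; apply/binary_finiteP; exists n.+1 => s /binary_levelE ->.
Qed.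

End BinaryTree.

(** Infinite almost disjoint subtrees are distinct, so a witness may be given as
an indexed family, with a set of indices in place of a set of subtrees. *)
Lemma at_witnessed_family (d : Order.disp_t) (T : porderType d) (K I : Type)
    (S : I -> set T) (Y : set I) :
  omega_tree T -> (forall i, subtree (S i)) -> (forall i, infinite_set (S i)) ->
  (forall i j, i <> j -> finite_set (S i `&` S j)) -> [set: I] #<= [set: K] ->
  (forall D : set T, (forall i, Y i -> infinite_set (D `&` S i)) ->
     (forall i, ~ Y i -> finite_set (D `&` S i)) -> False) ->
  at_witnessed K.
Proof.
move=> Ttree Ssub Sinf Sad IK noD; exists d, T, (range S), (S @` Y).
have Sinj i j : S i = S j -> i = j.
  move=> Sij; apply: contrapT => /Sad; rewrite Sij setIid; exact: Sinf.
split=> //.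
- split; first by move=> _ [i _ <-].
  by move=> _ _ [i _ <-] [j _ <-] Sij; apply: Sad => ij; apply: Sij; rewrite ij.
- exact: card_le_trans (card_image_le _ _) IK.
- by move=> _ [i _ <-]; exists i.
- move=> [D [DY DnY]]; apply: (noD D) => i Yi; first by apply: DY; exists i.
  by apply: DnY; split; [exists i|move=> [j Yj /Sinj ji]; apply: Yi; rewrite -ji].
Qed.

Definition branch (x : nat -> bool) : set binary_tree :=
  [set s | mkseq x (size s) = s].

Lemma branch_subtree x : subtree (branch x).
Proof.
split=> [|s t /= xt]; first by exists [::].
rewrite binary_leE => /eqP st; have sz : size s <= size t.
  by rewrite -st size_take_min geq_minr.
have := congr1 (take (size s)) xt.
by rewrite /mkseq -map_take take_iota (minn_idPl sz) st.
Qed.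

Lemma branch_infinite x : infinite_set (branch x).
Proof.
move=> /binary_finiteP[n /(_ (mkseq x n))].
by rewrite /branch/= size_mkseq ltnn => /(_ erefl).
Qed.

Lemma branch_almost_disjoint x y : x <> y -> finite_set (branch x `&` branch y).
Proof.
move=> xy; apply/binary_finiteP.
have [i xyi] := neq_fun_exists xy.
exists i.+1 => s [/= xs ys]; rewrite ltnS leqNgt; apply/negP => lt_is; apply: xyi.
by rewrite -(nth_mkseq false x lt_is) -(nth_mkseq false y lt_is) xs ys.
Qed.

(** Cantor's diagonal argument: there are too few subsets of the countable
binary tree to separate every set of branches from its complement. *)
Lemma at_witnessed_cantor : at_witnessed (nat -> bool).
Proof.
pose code (x : nat -> bool) := [set s : binary_tree | x (pickle (s : seq bool))].
pose Y := [set x | finite_set (code x `&` branch x)].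
apply: (@at_witnessed_family _ binary_tree _ (nat -> bool) branch Y).
- exact: binary_omega_tree.
- exact: branch_subtree.
- exact: branch_infinite.
- exact: branch_almost_disjoint.
- exact: card_lexx.
move=> D DY DnY.
pose x n := if (unpickle n : option (seq bool)) is Some s then `[< D s >] else false.
have xD : code x = D.
  apply/seteqP; split=> s; rewrite /code/= /x pickleK => /asboolP//.
have [Yx|Yx] := pselect (Y x).
  by have := DY x Yx; rewrite -{1}xD.
by apply: (Yx); rewrite /Y/= xD; exact: DnY.
Qed.

Lemma pad_neq_indicator (g : nat -> nat) s :
  (forall j, g j < g j.+1) -> pad s <> indicator g.
Proof.
move=> gS E; have gmono : {mono g : i j / i <= j}.
  by apply: leq_mono; apply: homo_ltn gS; exact: ltn_trans.
have ge_id j : j <= g j.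
  by elim: j => // j /leq_ltn_trans; apply; exact: gS.
have : indicator g (g (size s)) by apply/asboolP; exists (size s).
by rewrite -E /pad nth_default.
Qed.

(** * A concentrated set of binary sequences *)

(** Given an undominated family [g], the points [indicator (g k)] together with
the eventually zero sequences form a subspace of the Cantor space in which the
eventually zero sequences are not a G-delta set: every open set around them
catches all but a dominated part of the other points.  A subset of the binary
tree separating the branches through these sequences from the other branches
would exhibit them as a G-delta set, so the same points serve as a witness for
both cardinals. *)
Section ConcentratedSet.
Variables (K : Type) (g : K -> nat -> nat).
Hypothesis gS : forall k j, g k j < g k j.+1.
Hypothesis g_undominated : ~ eventually_dominated g.

(* The eventually zero sequences, enumerated through a coding of strings. *)
Let rational (n : nat) := pad (odflt [::] (unpickle n)).

Let rationalP s : range rational (pad s).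
Proof. by exists (pickle s) => //; rewrite /rational pickleK. Qed.

Definition concentrated_set : Type :=
  {x : nat -> bool | (range (fun k => indicator (g k)) `|` range rational) x}.

Let Y : set concentrated_set := [set z | range rational (sval z)].

Let point k : concentrated_set :=
  exist _ (indicator (g k)) (or_introl (imageT (fun k => indicator (g k)) k)).

Let rational_point s : concentrated_set :=
  exist _ (pad s) (or_intror (rationalP s)).

Let YP s : Y (rational_point s). Proof. exact: rationalP. Qed.

Let Ypoint k : ~ Y (point k).
Proof. by move=> [n _ /pad_neq_indicator]; apply; exact: gS. Qed.

Let sval_neq (z z' : concentrated_set) : z <> z' -> sval z <> sval z'.
Proof. by move=> zz' E; apply: zz'; case: z z' E => [x ?] [y ?] /= E; apply/eq_exist. Qed.

Lemma card_concentrated_set : [set: concentrated_set] #<= [set: K].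
Proof.
rewrite (card_le_eql (card_set_sig _)); apply: card_range_setU_countable.
exact: undominated_infinite g_undominated.
Qed.

Lemma concentrated_set_at : at_witnessed K.
Proof.
apply: (@at_witnessed_family _ binary_tree K concentrated_set (fun z => branch (sval z)) Y).
- exact: binary_omega_tree.
- by move=> z; exact: branch_subtree.
- by move=> z; exact: branch_infinite.
- by move=> z z' /sval_neq; exact: branch_almost_disjoint.
- exact: card_concentrated_set.
move=> D DY DnY; apply: g_undominated.
apply: (@dominated_of_string_sets _ g (fun n => [set s | D s /\ n <= size s])) => //.
  move=> n s; apply: contrapT => nm; apply: (DY _ (YP s)); apply/binary_finiteP.
  exists n => t [Dt /= st]; rewrite ltnNge; apply/negP => le_nt.
  by apply: nm; exists (size t); rewrite /= st.
move=> k; have /binary_finiteP[n Dn] := DnY _ (@Ypoint k); exists n => m [Dm].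
rewrite leqNgt Dn//; split=> //=.
by rewrite /branch/= size_mkseq.
Qed.

Lemma concentrated_set_q2 : exists2 L, q2_witnessed L & [set: L] #<= [set: K].
Proof.
exists concentrated_set; last exact: card_concentrated_set.
(* The index [i] codes the coordinate [i./2] and its value [odd i]. *)
pose S i := [set z : concentrated_set | sval z i./2 = odd i].
exists (generated_space S); split=> //.
- exact: generated_second_countable.
- apply: generated_hausdorff => z z' /sval_neq zz'.
  have [i zi] := neq_fun_exists zz'.
  exists [:: sval z i + i.*2], [:: sval z' i + i.*2]; split.
  + move=> j; rewrite inE => /eqP ->.
    by rewrite /S/= half_bit_double oddD odd_double addbF oddb.
  + move=> j; rewrite inE => /eqP ->.
    by rewrite /S/= half_bit_double oddD odd_double addbF oddb.
  + move=> u /(_ _ (mem_head _ _)) + /(_ _ (mem_head _ _)).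
    by rewrite /S/= !half_bit_double !oddD !odd_double !addbF !oddb => -> .
move=> /(_ Y)[F Fop YE]; apply: g_undominated.
apply: (@dominated_of_string_sets _ g (fun n => [set s | forall z : concentrated_set,
   mkseq (sval z) (size s) = s -> F n z])) => //.
  move=> n s; have : F n (rational_point s).
    by have := YP s; rewrite YE; apply.
  move: (Fop n) => /generated_openP Fn /Fn[l sl lF].
  exists (\max_(i <- l) i).+1 => z; rewrite size_mkseq => /eq_in_map E.
  apply: lF => i il; have := sl i il; rewrite /S/= => <-; apply: E.
  rewrite mem_iota/= add0n ltnS (@leq_trans i) ?leq_bigmax_seq//.
  by rewrite -{2}(odd_double_half i) -addnn addnCA leq_addr.
move=> k; have : ~ (\bigcap_i F i) (point k) by rewrite -YE; exact: Ypoint.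
move=> /existsNP[n /not_implyP[_ nF]]; exists n => m Om.
by apply: nF; apply: Om; rewrite size_mkseq.
Qed.

End ConcentratedSet.

(** Partial sums turn [f] into a strictly increasing family above it. *)
Lemma undominated_witnesses (K : Type) (f : K -> nat -> nat) :
  ~ eventually_dominated f ->
  at_witnessed K /\ exists2 L, q2_witnessed L & [set: L] #<= [set: K].
Proof.
move=> fND; pose g k j := \sum_(i < j.+1) (f k i).+1.
have gS k j : g k j < g k j.+1.
  by rewrite /g [leqRHS]big_ord_recr/= addnS ltnS leq_addr.
have gND : ~ eventually_dominated g.
  move=> [G gG]; apply: fND; exists G => k; have [n0 n0P] := gG k.
  exists n0 => n /n0P; apply: leq_trans.
  by rewrite /g big_ord_recr/= addnS; apply: leqW; rewrite leq_addl.
split; first exact: concentrated_set_at gS gND.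
exact: concentrated_set_q2 gS gND.
Qed.

(** * From almost disjoint subtrees to almost disjoint sets *)

Lemma omega_tree_countable (d : Order.disp_t) (T : porderType d) :
  omega_tree T -> exists e : T -> nat, injective e.
Proof.
move=> [_ _ [_ Tlevel] levelfin].
have /countable_injP[e einj] : countable [set: T].
  have -> : [set: T] = \bigcup_n level n.
    by apply/seteqP; split=> // t _; have [n tn] := Tlevel t; exists n.
  by apply: bigcup_countable => // n _; exact: finite_set_countable (levelfin n).
by exists e => s t; apply: einj; rewrite inE.
Qed.

Lemma finite_image_inj (T U : Type) (e : T -> U) (A : set T) :
  injective e -> finite_set (e @` A) -> finite_set A.
Proof.
move=> einj; rewrite (eq_finite_set (inj_card_eq (in2W einj)))//.
Qed.

Lemma image_setI_inj (T U : Type) (e : T -> U) (A B : set T) :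
  injective e -> e @` A `&` e @` B = e @` (A `&` B).
Proof.
move=> einj; apply/seteqP; split=> [_ [[t At <-] [u Bu /einj ut]]|_ [t [At Bt] <-]].
  by exists t => //; split=> //; rewrite -ut.
by split; exists t.
Qed.

(** The tree structure is forgotten: an omega-tree is countable, so the subtrees
become almost disjoint subsets of [nat]. *)
Lemma ap_of_at (K : Type) :
  at_witnessed K -> exists2 L, ap_witnessed L & [set: L] #<= [set: K].
Proof.
move=> [d [T [X [Y [Ttree [XP Xad] XK YX noD]]]]].
have [e einj] := omega_tree_countable Ttree.
pose E (S : set T) : set nat := e @` S.
have Einf S : infinite_set S -> infinite_set (E S).
  by move=> Sinf /(finite_image_inj einj).
have EI S S' : finite_set (S `&` S') -> finite_set (E S `&` E S').
  by move=> fin; rewrite /E image_setI_inj//; exact: finite_image.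
pose AB := E @` Y `|` E @` (X `\` Y).
have ABX : AB `<=` E @` X.
  by move=> _ [[S YS <-]|[S [XS _] <-]]; exists S => //; exact: YX.
exists {a | AB a}; last first.
  rewrite (card_le_eql (card_set_sig _)).
  exact: card_le_trans (subset_card_le ABX) (card_le_trans (card_image_le _ _) XK).
exists (E @` Y), (E @` (X `\` Y)); split.
- by split=> _ [S XS <-]; apply: Einf; apply: (XP S _).2; [exact: YX|case: XS].
- move=> _ _ [S YS <-] [S' [XS' YS'] <-]; apply: EI; apply: Xad => //; first exact: YX.
  by move=> SS'; apply: YS'; rewrite -SS'.
- by rewrite card_eq_sym card_set_sig.
- move=> a b /ABX[S XS <-] /ABX[S' XS' <-] ab; apply: EI; apply: Xad => // SS'.
  by apply: ab; rewrite SS'.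
move=> [D [DY DnY]]; apply: noD; exists (e @^-1` D); split=> S YS.
  move=> fin; apply: (DY (E S)); first by exists S.
  apply: sub_finite_set (finite_image e fin) => _ [[t St <-] Dt].
  by exists t.
apply: (finite_image_inj einj); apply: sub_finite_set (DnY (E S) _); last by exists S.
by move=> _ [t [Dt St] <-]; split=> //; exists t.
Qed.

(** * From second-countable Hausdorff spaces to subtrees *)

(** Every pair of disjoint members of the base is listed; the other pairs are
replaced by pairs of empty sets. *)
Lemma disjoint_open_pairs (Z : topologicalType) (B : set (set Z)) :
  countable B -> B `<=` open ->
  (forall x, filter_from [set U | B U /\ U x] id --> x) -> hausdorff_space Z ->
  exists U V : nat -> set Z,
    [/\ forall k, U k `&` V k = set0, forall k, open (U k), forall k, open (V k) &
     forall z z', z <> z' -> exists k, U k z /\ V k z'].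
Proof.
move=> /countable_injP[b binj] Bopen Bbase.
rewrite open_hausdorff => Zhaus.
pose W n := \bigcup_(U in [set U | B U /\ b U = n]) U.
have Wopen n : open (W n) by apply: bigcup_open => U [/Bopen].
have WB U : B U -> W (b U) = U.
  move=> BU; apply/seteqP; split=> [z [U' [BU' bU'] U'z]|z Uz]; last by exists U.
  by rewrite -(binj _ _ _ _ bU') ?inE.
pose p k := odflt (0, 0) (unpickle k : option (nat * nat)).
pose disj k := W (p k).1 `&` W (p k).2 = set0.
exists (fun k => if `[< disj k >] then W (p k).1 else set0).
exists (fun k => if `[< disj k >] then W (p k).2 else set0); split.
- by move=> k; case: asboolP => // _; rewrite setI0.
- by move=> k; case: asboolP => // _; exact: open0.
- by move=> k; case: asboolP => // _; exact: open0.
move=> z z' /eqP/Zhaus[[O O'] /= [/set_mem Oz /set_mem O'z'] [Oop O'op /eqP OO']].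
have [U [BU Uz] UO] := Bbase z O (open_nbhs_nbhs (conj Oop Oz)).
have [U' [BU' U'z'] UO'] := Bbase z' O' (open_nbhs_nbhs (conj O'op O'z')).
have pk : p (pickle (b U, b U')) = (b U, b U') by rewrite /p pickleK.
exists (pickle (b U, b U')); rewrite /disj pk /= !WB//; case: asboolP => //.
by case; apply: subsetI_eq0 OO'.
Qed.

(** Each pair of disjoint open sets [U k], [V k] gives a closed cover of the
space by the two complements, and a string selects one complement from each of
the first covers.  The strings whose selections contain [z] form a subtree
[S z], and these subtrees are almost disjoint because points separated by
[U k] and [V k] lie in no common selection past [k].  If [D] separated the
subtrees of [Y] from the others, then domination would give [G] such that
[z] is in [Y] exactly when, for all but finitely many [k], the subtree [S z]
meets [D] at a level between [k] and [G k].  Each of these conditions is a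
finite union of closed conditions, so [Y] would be an F-sigma set. *)
Lemma at_of_q2 (K : Type) : q2_witnessed K -> at_witnessed K.
Proof.
move=> [Z [[B Bcount [Bopen Bbase]]]] Zhaus /existsNP[Yc YcND].
rewrite card_eq_le => /andP[ZK _].
have at_K : at_witnessed Z -> at_witnessed K.
  move=> [d [T [X [Y [? ? XZ ? ?]]]]]; exists d, T, X, Y; split=> //.
  exact: card_le_trans XZ ZK.
apply: at_K.
have [U [V [UV Uopen Vopen UVsep]]] := disjoint_open_pairs Bcount Bopen Bbase Zhaus.
have [dom|[f /undominated_witnesses[]]//] : 
  (forall f : Z -> nat -> nat, eventually_dominated f) \/
  (exists f : Z -> nat -> nat, ~ eventually_dominated f).
  have [|nD] := pselect (exists f : Z -> nat -> nat, ~ eventually_dominated f).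
    by right.
  by left=> f; apply: contrapT => fND; apply: nD; exists f.
(* [true] selects the complement of [U k], [false] that of [V k]. *)
pose S z := [set s : binary_tree | forall k, k < size s ->
  if nth false s k then ~ U k z else ~ V k z].
pose Y := ~` Yc.
apply: (@at_witnessed_family _ binary_tree _ Z S Y).
- exact: binary_omega_tree.
- move=> z; split; first by exists [::].
  move=> s t St; rewrite binary_leE => /eqP st k lt_ks.
  have lt_kt : k < size t.
    by apply: leq_trans lt_ks _; rewrite -st size_take_min geq_minr.
  by have := St k lt_kt; rewrite -[in nth _ s k]st nth_take.
- move=> z /binary_finiteP[n nS].
  (* As [U k] and [V k] are disjoint, one of the two selections is always
     available. *)
  suff /nS : S z (mkseq (fun k => ~~ `[< U k z >]) n) by rewrite size_mkseq ltnn.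
  move=> k; rewrite size_mkseq => lt_kn; rewrite nth_mkseq//.
  case: asboolP => //= Uz Vz.
  by have : (U k `&` V k) z by []; rewrite UV.
- move=> z z' /UVsep[k [Uz Vz']]; apply/binary_finiteP; exists k.+1 => s [Ss Ss'].
  rewrite ltnS leqNgt; apply/negP => lt_ks.
  by have := Ss k lt_ks; have := Ss' k lt_ks; case: nth.
- exact: card_lexx.
move=> D DY DnY; apply: YcND.
pose hits z k G := exists s, [/\ D s, S z s, k <= size s & size s <= G].
have /choice[f fP] (zk : Z * nat) : exists G : nat, Y zk.1 -> hits zk.1 zk.2 G.
  case: zk => z k /=; have [Yz|] := pselect (Y z); last by exists 0.
  apply: contrapT => nhit; apply: (DY z Yz); apply/binary_finiteP; exists k => s [Ds Ss].
  rewrite ltnNge; apply/negP => le_ks; apply: nhit; exists (size s) => _.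
  by exists s.
have [G GP] := dom (fun z k => f (z, k)).
pose O n := \bigcup_(k in [set k | n <= k]) [set z | ~ hits z k (G k)].
exists O.
  move=> n; apply: bigcup_open => k _.
  have -> : [set z | ~ hits z k (G k)] =
    ~` \bigcup_(s in [set s : binary_tree | [/\ D s, k <= size s & size s <= G k]])
      [set z | S z s].
    apply/seteqP; split=> z nh.
      by move=> [s [Ds ? ?] Ss]; apply: nh; exists s.
    by move=> [s [Ds Ss ? ?]]; apply: nh; exists s.
  apply: closed_openC; apply: closed_bigcup.
    by apply/binary_finiteP; exists (G k).+1 => s [].
  move=> s _; rewrite -openC.
  have -> : ~` [set z | S z s] =
      \bigcup_(j in [set j | j < size s]) (if nth false s j then U j else V j).
    apply/seteqP; split=> z /=.
      move=> /existsNP[j /not_implyP[lt_js nSj]]; exists j => //.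
      by move: nSj; case: nth => /contrapT.
    by move=> [j lt_js USj] /(_ j lt_js); move: USj; case: nth.
  by apply: bigcup_open => j _; case: nth.
apply/seteqP; split=> z.
  move=> Ycz n _.
  have /binary_finiteP[m Dm] := DnY z (fun Yz => Yz Ycz).
  exists (maxn n m); first exact: leq_maxl.
  move=> [s [Ds Ss le_s _]]; have : size s < m by apply: Dm.
  by rewrite ltnNge (leq_trans (leq_maxr n m) le_s).
move=> Oz; apply: contrapT => Yz.
have [n0 n0P] := GP z; have [k le_k nh] := Oz n0 I; apply: nh.
have [s [Ds Ss ks sf]] := fP (z, k) Yz; exists s; split=> //.
exact: leq_trans sf (n0P _ le_k).
Qed.

(** * Levels and branches of omega-trees *)

Lemma finite_set_bounded (T : Type) (e : T -> nat) (A : set T) :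
  finite_set A -> exists N, forall t, A t -> e t < N.
Proof.
move=> /(finite_image e)/finite_seqP[l lE]; exists (\max_(i <- l) i).+1 => t At.
have etl : [set` l] (e t) by rewrite -lE; exists t.
by rewrite ltnS; exact: (@leq_bigmax_seq _ _ xpredT id).
Qed.

Lemma bounded_finite_set (T : Type) (e : T -> nat) (A : set T) N :
  injective e -> (forall t, A t -> e t < N) -> finite_set A.
Proof.
move=> einj AN; apply: (finite_image_inj einj); apply: sub_finite_set (finite_II N).
by move=> _ [t /AN ? <-].
Qed.

Section OmegaTree.
Variables (d : Order.disp_t) (T : porderType d).
Hypothesis Ttree : omega_tree T.
Import Order.POrderTheory.

Lemma tree_comparable (s t u : T) :
  (s <= u)%O -> (t <= u)%O -> (s <= t)%O \/ (t <= s)%O.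
Proof.
rewrite !le_eqVlt => /predU1P[->|su] /predU1P[->|tu]; rewrite ?eqxx; first by left.
- by right; rewrite tu orbT.
- by left; rewrite su orbT.
have [/(_ u)/wo_chainW/(_ s t)] := Ttree.
by rewrite !inE su tu -!le_eqVlt => /(_ isT isT)/orP.
Qed.

Lemma depth_exists : exists lv : T -> nat, forall t, level (lv t) t.
Proof. by have [_ _ [_ Tl] _] := Ttree; have /choice[lv] := Tl; exists lv. Qed.

Lemma card_down_closure (s t : T) m :
  level m s -> (s < t)%O -> [set u | (u <= s)%O] #= `I_m.+1.
Proof.
move=> sm st; apply/eq_cardSP; exists s; rewrite /=//.
rewrite (_ : _ `\` _ = [set u | (u < s)%O])//.
apply/seteqP; split=> u /=.
  by move=> [us /eqP nus]; rewrite lt_neqAle nus us.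
by move=> us; split; [exact: ltW|move=> E; move: us; rewrite E ltxx].
Qed.

Lemma level_unique (t : T) m n : level m t -> level n t -> m = n.
Proof. by rewrite /level/= => tm; rewrite (card_eql tm) => /card_eq_II. Qed.

Lemma level_lt (s t : T) m n : level m s -> level n t -> (s < t)%O -> m < n.
Proof.
move=> sm tn st; rewrite -card_le_II.
rewrite -(card_le_eql (card_down_closure sm st)).
rewrite -(card_le_eqr tn); apply: subset_card_le => u /= us.
exact: le_lt_trans us st.
Qed.

(** The predecessors of a node form a finite chain; its last element has exactly
one predecessor less, and the induction continues from there. *)
Lemma level_ancestor (t : T) n k : level n t -> k < n -> exists2 s, (s < t)%O & level k s.
Proof.
have [lv lvP] := depth_exists.
elim: n t => // n IHn t tn; rewrite ltnS leq_eqVlt => kn.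
pose Q m := `[< exists2 s, (s < t)%O & lv s = m >].
have Qex : exists m, Q m.
  move/eq_cardSP: (tn) => [s st _]; exists (lv s); apply/asboolP; exists s => //.
have Qbound m : Q m -> m <= n.+1.
  by move=> /asboolP[s st <-]; rewrite ltnW// (level_lt (lvP s) tn).
case: (ex_maxnP Qex Qbound) => m /asboolP[s st sm] m_max.
have pred_t : [set u | (u < t)%O] = [set u | (u <= s)%O].
  apply/seteqP; split=> u /= ut; last exact: le_lt_trans ut st.
  have [//|su] := tree_comparable (ltW ut) (ltW st).
  have [->//|us] := eqVneq u s.
  have /m_max : Q (lv u) by apply/asboolP; exists u.
  by rewrite -sm leqNgt (level_lt (lvP s) (lvP u))// lt_neqAle eq_sym us.
have sn : level n s.
  have := card_down_closure (lvP s) st; rewrite -pred_t (card_eql tn).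
  by move=> /card_eq_II[->]; exact: lvP.
case/predU1P: kn => [->|kn]; first by exists s.
by have [u us uk] := IHn s sn kn; exists u => //; exact: lt_trans us st.
Qed.

Lemma predecessors_finite (t : T) : finite_set [set s | (s < t)%O].
Proof. by have [lv lvP] := depth_exists; exists (lv t); exact: lvP. Qed.

Lemma level_finite n : finite_set (@level _ T n).
Proof. by have [_ _ _] := Ttree. Qed.

Lemma subtree_meets_level (S : set T) n :
  subtree S -> infinite_set S -> exists2 t, S t & level n t.
Proof.
move=> [_ Sdown] Sinf; apply: contrapT => nt.
have [lv lvP] := depth_exists.
apply: Sinf; apply: sub_finite_set (_ : finite_set (\bigcup_(k in `I_n) @level _ T k)).
  move=> t St; exists (lv t); last exact: lvP.
  rewrite /= ltnNge leq_eqVlt; apply/negP => /predU1P[nE|lt_n].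
    by apply: nt; exists t => //; rewrite nE; exact: lvP.
  have [s st sn] := level_ancestor (lvP t) lt_n.
  by apply: nt; exists s => //; apply: Sdown St (ltW st).
by apply: bigcup_finite => [|k _]; [exact: finite_II|exact: level_finite].
Qed.

(** Koenig's lemma.  A node with infinitely many extensions in [S] has a strictly
larger such node, as the next level is finite; a sequence of such nodes
generates the branch. *)
Lemma subtree_contains_branch (S : set T) : subtree S -> infinite_set S ->
  exists P : set T, [/\ subtree P, infinite_set P, P `<=` S &
    forall s t, P s -> P t -> (s <= t)%O \/ (t <= s)%O].
Proof.
move=> [S0 Sdown] Sinf; have [lv lvP] := depth_exists.
have [r rP] : rooted T by case: Ttree.
pose big := {t : T | infinite_set [set u | S u /\ (t <= u)%O]}.
have step (t : big) : {t' : big | (sval t < sval t')%O}.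
  case: t => t tbig; apply: cid; apply: contrapT => nt'; apply: (tbig).
  pose next := [set t' | level (lv t).+1 t' /\ (t < t')%O].
  apply: sub_finite_set (_ : finite_set ([set t] `|`
     \bigcup_(t' in next) [set u | S u /\ (t' <= u)%O])).
    move=> u [Su]; rewrite le_eqVlt => /predU1P[->|tu]; [by left|right].
    have := level_lt (lvP t) (lvP u) tu; rewrite leq_eqVlt => /predU1P[E|lt_u].
      by exists u; split=> //; rewrite E; exact: lvP.
    have [t' t'u lt'] := level_ancestor (lvP u) lt_u.
    exists t'; last by split=> //; exact: ltW.
    split=> //; have t't : t' <> t.
      move=> E; move: lt'; rewrite E => /(level_unique (lvP t))/eqP.
      by rewrite eqn_leq ltnn andbF.
    have [tt'|le_t't] := tree_comparable (ltW tu) (ltW t'u).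
      by rewrite lt_neqAle tt' andbT eq_sym; apply/eqP.
    have : (t' < t)%O by rewrite lt_neqAle le_t't andbT; apply/eqP.
    by move=> /(level_lt lt' (lvP t)); rewrite ltnNge leqnSn.
  rewrite finite_setU; split; first exact: finite_set1.
  apply: bigcup_finite => [|t' [_ tt']].
    by apply: sub_finite_set (level_finite (lv t).+1) => t' [].
  by apply: contrapT => t'big; apply: nt'; exists (exist _ t' t'big).
have rbig : infinite_set [set u | S u /\ (r <= u)%O].
  by apply: sub_infinite_set Sinf => u Su; split.
have [b [_ bS]] := dependent_choice step (exist _ r rbig).
have b_mono : {homo (fun n => sval (b n)) : m n / m <= n >-> (m <= n)%O}.
  by apply: homo_leq => [t|t s u|n]; [exact: lexx|exact: le_trans|exact: ltW (bS n)].
exists [set s | exists n, (s <= sval (b n))%O]; split.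
- split; first by exists (sval (b 0)), 0.
  by move=> s t [n tn] st; exists n; exact: le_trans tn.
- move=> /(finite_set_bounded lv)[N NP].
  have lv_ge n : n <= lv (sval (b n)).
    by elim: n => // n /leq_ltn_trans; apply; apply: level_lt (lvP _) (lvP _) (bS n).
  by have := NP (sval (b N)) (ex_intro _ N (lexx _)); rewrite ltnNge lv_ge.
- move=> s [n sn]; case: (b n) sn => t tbig /= st.
  have [u [Su tu]] := infinite_setN0 tbig.
  exact: Sdown Su (le_trans st tu).
move=> s t [m sm] [n tn]; apply: (@tree_comparable _ _ (sval (b (maxn m n)))).
  by apply: le_trans sm (b_mono _ _ _); exact: leq_maxl.
by apply: le_trans tn (b_mono _ _ _); exact: leq_maxr.
Qed.

End OmegaTree.

(** * From subtrees to second-countable Hausdorff spaces *)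

(** The indices [i] of an almost disjoint family of infinite subtrees [P i]
are the points of a space in which the basic open sets consist of the [i] for
which [P i] avoids a given finite set of nodes. *)
Section AvoidanceSpace.
Variables (d : Order.disp_t) (T : porderType d) (I : Type) (P : I -> set T).
Variable e : T -> nat.
Hypotheses (Ttree : omega_tree T) (e_inj : injective e).
Hypotheses (Psub : forall i, subtree (P i)) (Pinf : forall i, infinite_set (P i)).
Hypothesis Pad : forall i j, i <> j -> finite_set (P i `&` P j).

Definition avoidance_subbase (n : nat) : set I :=
  [set i | forall t, e t = n -> ~ P i t].

(** Past the finite intersection of [P i] and [P j], take a level [n].  If [P k]
avoids the nodes of level [n] outside [P i], and also those outside [P j], then
it has no node on level [n], which is impossible for an infinite subtree. *)
Lemma avoidance_hausdorff : hausdorff_space (generated_space avoidance_subbase).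
Proof.
apply: generated_hausdorff => i j ij.
have [lv lvP] := depth_exists Ttree.
have [n nP] := finite_set_bounded lv (Pad ij).
have /finite_seqP[l lE] := level_finite Ttree n.
have lP t : level n t <-> t \in l by rewrite -[X in X <-> _]/(level n t) lE.
exists (map e [seq t <- l | t \notin P i]), (map e [seq t <- l | t \notin P j]).
split.
- move=> _ /mapP[t + ->] u /e_inj ->; rewrite mem_filter => /andP[+ _] Pt.
  by rewrite mem_set.
- move=> _ /mapP[t + ->] u /e_inj ->; rewrite mem_filter => /andP[+ _] Pt.
  by rewrite mem_set.
move=> k ki kj.
have [t Pkt tn] := subtree_meets_level Ttree n (Psub k) (@Pinf k).
have inP i0 : basic_open (S := avoidance_subbase)
    (map e [seq t <- l | t \notin P i0]) k -> P i0 t.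
  move=> /(_ (e t)) ki0; apply: contrapT => nPt.
  apply: (ki0 _ t erefl Pkt).
  apply: map_f; rewrite mem_filter; apply/andP; split; last exact/lP.
  by rewrite notin_setE.
have := nP t (conj (inP _ ki) (inP _ kj)).
by rewrite (level_unique tn (lvP t)) ltnn.
Qed.

Variable Y : set I.
Hypothesis Pchain : forall i, Y i ->
  forall s t, P i s -> P i t -> (s <= t)%O \/ (t <= s)%O.

(** Let [Y] be the union of the complements of the open sets [F n], and let [U n]
be the union of the branches [P i] with [i] outside [F n].  For [j] not in [Y]
the point [j] has a neighbourhood inside [F n], hence a finite set [A] avoided
by [P j] but met by each of these branches.  A node common to [P j] and such a
branch is comparable with a node of [A], and must be below it since [P j] is
closed downwards; so [P j] meets [U n] in a finite set.  Domination now allows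
one finite part to be removed from each [U n] so that the union of what remains
meets [P j] in a finite set, while it still contains almost all of each branch
indexed by [Y]. *)
Lemma avoidance_Gdelta_separated : (forall f : I -> nat -> nat, eventually_dominated f) ->
  @Gdelta (generated_space avoidance_subbase) (~` Y) ->
  exists D : set T, (forall i, Y i -> infinite_set (D `&` P i)) /\
    (forall i, ~ Y i -> finite_set (D `&` P i)).
Proof.
move=> dom [F Fop FE].
pose U n := \bigcup_(i in ~` F n) P i.
have U_fin j n : ~ Y j -> finite_set (P j `&` U n).
  move=> nYj; have Fj : F n j by have : (~` Y) j := nYj; rewrite FE; apply.
  move: (Fop n) => /generated_openP Fn; have [l jl lF] := Fn _ Fj.
  apply: sub_finite_set (_ : finite_set
      (\bigcup_(a in [set a | e a \in l]) [set t | (t < a)%O])).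
    move=> t [Pjt [i nFi Pit]].
    have Yi : Y i.
      apply: contrapT => nYi; apply: nFi.
      by have : (~` Y) i := nYi; rewrite FE; apply.
    have [m ml [a am Pia]] : exists2 m, m \in l & exists2 a, e a = m & P i a.
      apply: contrapT => nm; apply/nFi/lF => m ml a am Pia; apply: nm.
      by exists m => //; exists a.
    exists a; first by rewrite /= am.
    have nPja : ~ P j a by apply: jl am.
    have [ta|ta] := Pchain Yi Pit Pia; last by case: nPja; apply: (Psub j).2 Pjt ta.
    rewrite /= Order.POrderTheory.lt_neqAle ta andbT.
    by apply/eqP => E; apply: nPja; rewrite -E.
  apply: bigcup_finite => [|a _]; last exact: predecessors_finite.
  apply: (@bounded_finite_set _ e _ (\max_(m <- l) m).+1) => // a al.
  by rewrite ltnS; exact: (@leq_bigmax_seq _ _ xpredT id).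
have /choice[f fP] (jn : I * nat) : exists N, ~ Y jn.1 ->
    forall t, P jn.1 t -> U jn.2 t -> e t < N.
  have [Yj|nYj] := pselect (Y jn.1); first by exists 0.
  have [N NP] := finite_set_bounded e (U_fin jn.1 jn.2 nYj).
  by exists N => _ t Pt Ut; exact: NP.
have [G GP] := dom (fun j n => f (j, n)).
exists [set t | exists2 n, U n t & G n <= e t]; split=> [i Yi fin|j nYj].
  have [n nFi] : exists n, ~ F n i.
    apply: contrapT => nn; have : (\bigcap_n F n) i.
      by move=> n _; apply: contrapT => nFi; apply: nn; exists n.
    by rewrite -FE; apply.
  apply: (@Pinf i); apply: sub_finite_set (_ : finite_set ([set t | e t < G n] `|`
    ([set t | exists2 n, U n t & G n <= e t] `&` P i))).
    move=> t Pit; have [lt_t|le_t] := ltnP (e t) (G n); [by left|right].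
    by split=> //; exists n => //; exists i.
  rewrite finite_setU; split=> //.
  exact: (@bounded_finite_set _ e _ (G n)).
have [n0 n0P] := GP j.
apply: sub_finite_set (_ : finite_set (\bigcup_(n in `I_n0) (P j `&` U n))).
  move=> t [[n Unt Gn] Pjt]; exists n => //=.
  rewrite ltnNge; apply/negP => /n0P; rewrite leqNgt; apply/negP.
  rewrite negbK; exact: leq_ltn_trans Gn (fP (j, n) nYj t Pjt Unt).
by apply: bigcup_finite => [|n _]; [exact: finite_II|exact: U_fin].
Qed.

End AvoidanceSpace.

(** Only the subtrees outside [Y] have to be almost avoided in full, so those in
[Y] may be replaced by branches: this is what makes nodes comparable in the
previous argument. *)
Lemma q2_of_at (K : Type) :
  at_witnessed K -> exists2 L, q2_witnessed L & [set: L] #<= [set: K].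
Proof.
move=> [d [T [X [Y [Ttree [XP Xad] XK YX noD]]]]].
pose I := {S : set T | X S}.
have IK : [set: I] #<= [set: K] by rewrite (card_le_eql (card_set_sig _)).
suff [L Lq2 LI] : exists2 L, q2_witnessed L & [set: L] #<= [set: I].
  by exists L => //; exact: card_le_trans LI IK.
have [[f /undominated_witnesses[_]]//|dom] :=
  pselect (exists f : I -> nat -> nat, ~ eventually_dominated f).
have {}dom (f : I -> nat -> nat) : eventually_dominated f.
  by apply: contrapT => fND; apply: dom; exists f.
have [e e_inj] := omega_tree_countable Ttree.
pose YI := [set i : I | Y (sval i)].
have /choice[P PP] (i : I) : exists P : set T, [/\ subtree P, infinite_set P, P `<=` sval i,
    YI i -> forall s t, P s -> P t -> (s <= t)%O \/ (t <= s)%O & ~ YI i -> P = sval i].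
  case: i => S XS; have [Ssub Sinf] := XP S XS.
  have [Yi|nYi] := pselect (Y S); last by exists S; split.
  have [P [? ? ? Pchain]] := subtree_contains_branch Ttree Ssub Sinf.
  by exists P; split.
have Pad i j : i <> j -> finite_set (P i `&` P j).
  move=> ij; have [_ _ Pi _ _] := PP i; have [_ _ Pj _ _] := PP j.
  apply: sub_finite_set (setISS Pi Pj) _; apply: Xad; [exact: (svalP i)|exact: (svalP j)|].
  by move=> E; apply: ij; case: i j E {Pi Pj} => [S ?] [S' ?] /= E; apply/eq_exist.
have Psub i : subtree (P i) by have [] := PP i.
have Pinf i : infinite_set (P i) by have [] := PP i.
exists I => //; exists (generated_space (avoidance_subbase P e)); split=> //.
- exact: generated_second_countable.
- exact: avoidance_hausdorff.
move=> /(_ (~` YI)).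
move=> /(avoidance_Gdelta_separated Ttree e_inj Psub Pinf _ dom)[i Yi|D [DY DnY]].
  by have [_ _ _ + _] := PP i; apply.
apply: noD; exists D; split=> S XS.
  have YS := YX _ XS; have [_ _ Pi _ _] := PP (exist _ S YS).
  apply: sub_infinite_set (DY (exist _ S YS) XS); exact: setIS.
case: XS => XS nYS; have := DnY (exist _ S XS) nYS.
by have [_ _ _ _ ->] := PP (exist _ S XS).
Qed.

(** * Comparison of the three cardinals *)

Theorem theorem14 :
  exists ap at' q2 : Type,
    [/\ is_ap ap, is_at at', is_q2 q2,
        [set: ap] #<= [set: at'] & [set: at'] #= [set: q2]].
Proof.
have [at' at_min] : exists K, is_at K.
  apply: least_cardinal_exists at_witnessed_cantor => K L.
  rewrite card_eq_le => /andP[KL _] [d [T [X [Y [? ? XK ? ?]]]]].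
  by exists d, T, X, Y; split=> //; exact: card_le_trans XK KL.
have [L0 L0q2 L0_at] := q2_of_at at_min.1.
have [q2 q2_min] : exists K, is_q2 K.
  apply: least_cardinal_exists L0q2 => K L KL [X [? ? ? XK]].
  by exists X; split=> //; exact: card_eq_trans XK KL.
have [L1 L1ap L1_at] := ap_of_at at_min.1.
have [ap ap_min] : exists K, is_ap K.
  apply: least_cardinal_exists L1ap => K L KL [A [B [? ? ABK ? ?]]].
  by exists A, B; split=> //; exact: card_eq_trans ABK KL.
exists ap, at', q2; split=> //.
  exact: card_le_trans (ap_min.2 _ L1ap) L1_at.
rewrite card_eq_le (at_min.2 _ (at_of_q2 q2_min.1)).
exact: card_le_trans (q2_min.2 _ L0q2) L0_at.
Qed.
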